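(* Let the smooth component $f$ of the problem $\min_{x\in Q}\{F(x)=f(x)+\psi(x)\}$ be Quasi-Self-Concordant with parameter $M>0$, and let $x_0\in Q$ be such that $\lambda(x_0)>0$ (then $\lambda(x)>0$ for all $x\in Q$). Consider the iterations $\{x_k\}_{k\ge0}$ of the Newton Method with Gradient Regularization described in the context, with any $\sigma_k\in[0,2M]$, and set $\eta(x_k)=\|F'(x_k)\|_*/\lambda(x_k)$. Assume that $\eta(x_0)\le\frac1{18M}$. Then for all $k\ge0$, $$\eta(x_k)\ \le\ \frac1{9M}\cdot\Bigl(\frac12\Bigr)^{2^k}.$$
   Context: $\mathbb{E}$ is a finite-dimensional real vector space with dual $\mathbb{E}^*$; $\langle s,x\rangle$ denotes the value of $s\in\mathbb{E}^*$ at $x\in\mathbb{E}$. A self-adjoint positive-definite operator $B:\mathbb{E}\to\mathbb{E}^*$ is fixed, with norms $\|h\|=\langle Bh,h\rangle^{1/2}$ on $\mathbb{E}$ and $\|s\|_*=\langle s,B^{-1}s\rangle^{1/2}$ on $\mathbb{E}^*$. For $x\in Q$ write $\|h\|_x=\langle\nabla^2f(x)h,h\rangle^{1/2}$ and $\lambda(x)=\max\{\lambda\ge0:\nabla^2f(x)-\lambda B\succeq0\}$. Problem: $F^\star=\min_{x\in Q}\{F(x)=f(x)+\psi(x)\}$, where $\psi:\mathbb{E}\to\mathbb{R}\cup\{+\infty\}$ is a closed convex proper function, $Q=\operatorname{dom}\psi$, and $f:Q\to\mathbb{R}$ is convex and several times (at least three times) differentiable, with $\nabla f(x)\in\mathbb{E}^*$,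 $\nabla^2f(x)\succeq0$ and $D^3f(x)$ (a symmetric trilinear form) defined at every $x\in Q$. A minimizer exists. $f$ is Quasi-Self-Concordant with parameter $M$ if $D^3f(x)[u,u,v]\le M\|u\|_x^2\|v\|$ for all $x\in Q$ and $u,v\in\mathbb{E}$. $\partial F(x)$ is the convex subdifferential of $F$. Newton Method with Gradient Regularization: given $x_0\in Q$, $F'(x_0)\in\partial F(x_0)$ and $g_0=\|F'(x_0)\|_*$, for $k\ge0$ choose $\sigma_k\ge0$ and set $$x_{k+1}=\arg\min_{y\in Q}\Bigl\{\langle\nabla f(x_k),y-x_k\rangle+\tfrac12\|y-x_k\|_{x_k}^2+\tfrac{\sigma_kg_k}{2}\|y-x_k\|^2+\psi(y)\Bigr\},$$ $$F'(x_{k+1})=\nabla f(x_{k+1})-\nabla f(x_k)-\nabla^2f(x_k)(x_{k+1}-x_k)-\sigma_kg_kB(x_{k+1}-x_k)\in\partial F(x_{k+1}),\qquad g_{k+1}=\|F'(x_{k+1})\|_*.$$ The quantity $\eta(x_k)$ uses this selection of subgradients $F'(x_k)$. *)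

(* Defs.v *)
From HB Require Import structures.
From mathcomp Require Import all_boot all_order all_algebra.
From mathcomp Require Import interval_inference boolp classical_sets.
From mathcomp Require Import reals constructive_ereal ereal convex.

Set Implicit Arguments.
Unset Strict Implicit.
Unset Printing Implicit Defensive.
Import Order.TTheory GRing.Theory Num.Theory.

Local Open Scope classical_set_scope.
Local Open Scope ring_scope.

Section FiniteDimensionalSpace.
Context {R : realType} {E : vectType R}.

(* E^*; the value <s, x> is the application s x. *)
Definition dual : vectType R := 'Hom(E, R^o).

(* An operator E -> E^* is also read as a bilinear form: A u v = <A u, v>. *)
Definition operator : vectType R := 'Hom(E, dual).

(* T u v w is the value T[u, v, w]. *)
Definition trilinear_form : vectType R := 'Hom(E, operator).

Definition self_adjoint (A : operator) : Prop := forall u v : E, A u v = A v u.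

Definition psd (A : operator) : Prop :=
  self_adjoint A /\ forall u : E, 0 <= (A u u : R).

Definition posdef (A : operator) : Prop :=
  self_adjoint A /\ forall u : E, u != 0 -> 0 < (A u u : R).

Definition symmetric_trilinear (T : trilinear_form) : Prop :=
  forall u v w : E, T u v w = T v u w /\ T u v w = T u w v.

(* ||h|| is [norm_of B h] and ||h||_x is [norm_of (hess x) h]. *)
Definition norm_of (A : operator) (h : E) : R := Num.sqrt (A h h : R).

(* For B positive definite, B is bijective and B^-1%VF is its inverse. *)
Definition dual_norm (B : operator) (s : dual) : R :=
  Num.sqrt (s ((B^-1)%VF s) : R).

(* max {l >= 0 : A - l B >= 0}.  When A is positive semidefinite, B is positive
   definite and E is nonzero, this set is nonempty, bounded and closed, so that
   the supremum is the maximum.  When E is zero the maximum does not exist, and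
   [sup] returns 0. *)
Definition min_curvature (B A : operator) : R :=
  sup [set l : R | 0 <= l /\ psd (A - l *: B)].

Definition dom (psi : E -> \bar R) : set E := [set x | (psi x < +oo)%E].

Definition proper_function (psi : E -> \bar R) : Prop :=
  (forall x, psi x != -oo%E) /\ dom psi !=set0.

(* The term with coefficient 0 is 0, also where psi is +oo (0 * +oo = 0). *)
Definition convex_efunction (psi : E -> \bar R) : Prop :=
  forall (t : R) (x y : E), 0 <= t <= 1 ->
    (psi (t *: x + (1 - t) *: y)%R <= t%:E * psi x + (1 - t)%:E * psi y)%E.

(* The complement of the epigraph {(x, a) : psi x <= a} is open.  The topology
   of E is the one of the norm given by B. *)
Definition closed_function (B : operator) (psi : E -> \bar R) : Prop :=
  forall (x : E) (a : R), (a%:E < psi x)%E ->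
    exists2 d : R, 0 < d &
      forall (y : E) (b : R), norm_of B (y - x) < d -> `|b - a| < d ->
        (b%:E < psi y)%E.

(* f is a function on Q, and Q need not be open: its derivatives are Frechet
   derivatives relative to Q.  The values of f, grad, hess and d3 outside Q are
   irrelevant. *)
Definition gradient_on (B : operator) (Q : set E) (f : E -> R)
    (grad : E -> dual) : Prop :=
  forall x, Q x -> forall e : R, 0 < e -> exists2 d : R, 0 < d &
    forall y, Q y -> norm_of B (y - x) < d ->
      `|f y - f x - (grad x (y - x) : R)| <= e * norm_of B (y - x).

Definition hessian_on (B : operator) (Q : set E) (grad : E -> dual)
    (hess : E -> operator) : Prop :=
  forall x, Q x -> forall e : R, 0 < e -> exists2 d : R, 0 < d &
    forall y, Q y -> norm_of B (y - x) < d ->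
      dual_norm B (grad y - grad x - hess x (y - x)) <= e * norm_of B (y - x).

(* The bound for all u says that the operator norm of the remainder is at most
   e * ||y - x||. *)
Definition third_derivative_on (B : operator) (Q : set E) (hess : E -> operator)
    (d3 : E -> trilinear_form) : Prop :=
  forall x, Q x -> forall e : R, 0 < e -> exists2 d : R, 0 < d &
    forall y, Q y -> norm_of B (y - x) < d -> forall u : E,
      dual_norm B ((hess y - hess x - d3 x (y - x)) u)
        <= e * norm_of B (y - x) * norm_of B u.

Definition quasi_self_concordant (B : operator) (Q : set E)
    (hess : E -> operator) (d3 : E -> trilinear_form) (M : R) : Prop :=
  forall x, Q x -> forall u v : E,
    (d3 x u u v : R) <= M * norm_of (hess x) u ^+ 2 * norm_of B v.

Definition objective (f : E -> R) (psi : E -> \bar R) (x : E) : \bar R :=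
  ((f x)%:E + psi x)%E.

Definition argmin (Q : set E) (m : E -> \bar R) : set E :=
  [set z | Q z /\ forall y, Q y -> (m z <= m y)%E].

Definition subdifferential (F : E -> \bar R) (x : E) : set dual :=
  [set s | forall y, (F x + (s (y - x)%R : R)%:E <= F y)%E].

(* The objective of one step from z, with regularization coefficient
   r = sigma_k g_k. *)
Definition newton_model (B : operator) (grad : E -> dual) (hess : E -> operator)
    (psi : E -> \bar R) (r : R) (z y : E) : \bar R :=
  (((grad z (y - z) : R) + 2^-1 * norm_of (hess z) (y - z) ^+ 2
     + r / 2 * norm_of B (y - z) ^+ 2)%:E + psi y)%E.

(* s k is the subgradient F'(x_k).  For k >= 1 its membership in the
   subdifferential of F at x_k follows from the optimality of x_k in its
   subproblem, and is not a separate requirement. *)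
Definition newton_iterates (B : operator) (f : E -> R) (grad : E -> dual)
    (hess : E -> operator) (psi : E -> \bar R) (x0 : E) (sigma : nat -> R)
    (x : nat -> E) (s : nat -> dual) : Prop :=
  let g k := dual_norm B (s k) in
  [/\ x 0%N = x0,
      subdifferential (objective f psi) x0 (s 0%N),
      forall k, argmin (dom psi)
        (newton_model B grad hess psi (sigma k * g k) (x k)) (x k.+1) &
      forall k, s k.+1 = grad (x k.+1) - grad (x k)
        - hess (x k) (x k.+1 - x k)
        - (sigma k * g k) *: B (x k.+1 - x k)].

End FiniteDimensionalSpace.

Arguments dual {R} E.
Arguments operator {R} E.
Arguments trilinear_form {R} E.

(* Main.v *)
Require Import Defs.
From HB Require Import structures.
From mathcomp Require Import all_boot all_order all_algebra.
From mathcomp Require Import interval_inference boolp classical_sets.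
From mathcomp Require Import reals constructive_ereal ereal convex.
From mathcomp Require Import topology normedtype sequences derive realfun exp.
From mathcomp Require Import ring lra.
Import Order.TTheory GRing.Theory Num.Theory.
Set Implicit Arguments.
Unset Strict Implicit.
Unset Printing Implicit Defensive.
Import numFieldNormedType.Exports.
Local Open Scope classical_set_scope.
Local Open Scope ring_scope.

(** Along a segment of length r, quasi-self-concordance says that the
derivative of t |-> <hess(x + t h) u, u> is at most M r times the function
itself.  Gronwall's inequality then makes the Hessians at the two endpoints
comparable up to the factor e^(M r) ([hess_growth]).  This gives at once that
the smallest curvature lambda drops by at most that factor
([min_curvature_segment]), hence stays positive on all of Q, and, after
integrating D^3 f[h, h, v] twice, that the gradient differs from its
linearization by at most M e^(M r) ||h||_x^2 in dual norm ([grad_taylor]).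

Let h be the step from x_k, r = ||h||, g = g_k and lambda = lambda(x_k).  The
vector F'(x) - grad f(x) is a subgradient of psi at each iterate: at x_0 because
F'(x_0) is a subgradient of F, at the later ones because they minimize the
Newton model.  Adding the subgradient inequalities of psi at x_k and x_{k+1}
gives
     ||h||_x^2 + sigma g r^2 <= - <F'(x_k), h> <= g r,
hence r <= g / lambda = eta_k and ||h||_x^2 <= g eta_k.  By its definition
F'(x_{k+1}) is the linearization error of the gradient minus sigma g B h, so
     g_{k+1} <= M e^(M r) ||h||_x^2 + sigma g r <= M (e^(M eta_k) + 2) g eta_k,
and dividing by lambda(x_{k+1}) >= e^(- M eta_k) lambda(x_k),
     eta_{k+1} <= M (e^(M eta_k) + 2) e^(M eta_k) eta_k^2.
While M eta_k <= 1/18 the factor (e^(M eta_k) + 2) e^(M eta_k) is below 9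
([newton_contraction]), so 9 M eta_{k+1} <= (9 M eta_k)^2, where 9 M eta_0 is at
most 1/2 ([quadratic_rate]). *)

(** * Differentiation relative to the unit interval *)

(** At the endpoints the derivative is one-sided: this is what differentiability
relative to Q yields along a segment whose endpoints may lie on the boundary of
Q. *)
Definition derive_on01 {R : realType} (p dp : R -> R) : Prop :=
  forall t : R, 0 <= t <= 1 -> forall e : R, 0 < e -> exists2 d : R, 0 < d &
    forall t' : R, 0 <= t' <= 1 -> `|t' - t| < d ->
      `|p t' - p t - (t' - t) * dp t| <= e * `|t' - t|.

Lemma derive_on01_is_derive {R : realType} (p dp : R -> R) (t : R) :
  derive_on01 p dp -> 0 < t < 1 -> is_derive t 1 p (dp t).
Proof.
move=> pD /andP[t0 t1].
have cv : h^-1 *: ((p \o shift t) (h *: 1) - p t) @[h --> 0^'] --> dp t.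
  apply/cvgrPdist_le => /= e e0.
  have [|d d0 dP] := pD t _ e e0; first by rewrite !ltW.
  exists (Num.min d (Num.min t (1 - t))) => /=.
    by rewrite !lt_min d0 t0 subr_gt0.
  move=> h /=; rewrite sub0r normrN !lt_min => /and3P[hd ht h1] hN0.
  have := dP (h + t); rewrite addrK => /(_ _ hd) H.
  rewrite /GRing.scale /= mulr1 -[dp t](mulKf hN0) -mulrBr normrM normfV ler_pdivrMl ?normr_gt0//.
  rewrite distrC [leRHS]mulrC; apply: H.
  by move: ht h1; rewrite !ltr_norml => /andP[? ?] /andP[? ?]; apply/andP; split; lra.
by apply: DeriveDef; [apply/cvg_ex; exists (dp t)|exact/cvg_lim].
Qed.

Lemma derive_on01_continuous {R : realType} (p dp : R -> R) :
  derive_on01 p dp -> {within `[0, 1], continuous p}.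
Proof.
move=> pD; apply/subspace_continuousP => t /=; rewrite in_itv /= => t01.
apply/cvgrPdist_le => /= e e0.
have [d d0 dP] := pD t t01 1 ltr01.
have k0 : 0 < 1 + `|dp t| by rewrite ltr_pwDl.
exists (Num.min d (e / (1 + `|dp t|))) => /=.
  by rewrite lt_min d0 divr_gt0.
move=> u /=; rewrite distrC lt_min => /andP[ud ue]; rewrite in_itv /= => u01.
rewrite distrC; have := dP u u01 ud; rewrite mul1r => H.
rewrite -(subrK ((u - t) * dp t) (p u - p t)) (le_trans (ler_normD _ _))//.
rewrite (le_trans (lerD H (lexx _)))// normrM -{1}[`|u - t|]mulr1 -mulrDr.
by rewrite -ler_pdivlMr// ltW.
Qed.

Lemma mean_value_le {R : realType} (p dp : R -> R) (K : R) :
  derive_on01 p dp -> (forall t, 0 <= t <= 1 -> dp t <= K) -> p 1 - p 0 <= K.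
Proof.
move=> pD pK.
have [|t t01 ->] := @MVT R p dp 0 1 ltr01 _ (@derive_on01_continuous _ _ _ pD).
  by move=> t; rewrite in_itv /=; exact: derive_on01_is_derive.
rewrite subr0 mulr1; apply: pK; move: t01; rewrite in_itv /= => /andP[? ?].
by rewrite !ltW.
Qed.

(** The function p(t) e^(-c t) is nonincreasing. *)
Lemma gronwall_le {R : realType} (p dp : R -> R) (c : R) :
  derive_on01 p dp -> (forall t, 0 <= t <= 1 -> dp t <= c * p t) ->
  p 1 <= expR c * p 0.
Proof.
move=> pD pc.
pose w (t : R) : R := expR (- c * t).
have wD (t : R) : is_derive t (1 : R) w (- c * w t).
  have lD : is_derive t (1 : R) (fun u : R => - c * u) (- c).
    rewrite -[X in is_derive _ _ _ X]mulr1.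
    exact: (@is_deriveZ _ _ _ id (- c) t 1 1).
  by rewrite mulrC; apply: (@is_derive1_comp _ expR _ t (w t) (- c)).
have [||t t01] := @MVT R (fun t => p t * w t) (fun t => p t *: (- c * w t) + w t *: dp t) 0 1 ltr01.
- move=> t; rewrite in_itv /= => t01.
  by apply: (@is_deriveM _ _ p w); exact: derive_on01_is_derive.
- apply/subspace_continuousP => t t01; apply: (@cvgM R _ _ _ p w).
    exact: (iffLR (subspace_continuousP _ _) (@derive_on01_continuous _ _ _ pD)).
  apply: cvg_within_filter; apply/differentiable_continuous/derivable1_diffP.
  by have [] := wD t.
rewrite subr0 mulr1 /w /= !mulr1 mulr0 expR0 mulr1 => E.
have H : p 1 * expR (- c) - p 0 <= 0.
  rewrite E /GRing.scale /=.
  have -> : p t * (- c * expR (- c * t)) + expR (- c * t) * dp t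
     = expR (- c * t) * (dp t - c * p t) by ring.
  rewrite pmulr_rle0 ?expR_gt0// subr_le0; apply: pc.
  by move: t01; rewrite in_itv /= => /andP[? ?]; rewrite !ltW.
by rewrite subr_le0 expRN ler_pdivrMr ?expR_gt0// mulrC in H.
Qed.

(** * Norms defined by operators *)

Lemma sqr_norm_of {R : realType} {E : vectType R} (A : operator E) (u : E) :
  psd A -> norm_of A u ^+ 2 = A u u.
Proof. by case=> _ A0; rewrite sqr_sqrtr. Qed.

Lemma posdef_psd {R : realType} {E : vectType R} (B : operator E) :
  posdef B -> psd B.
Proof.
case=> sB pB; split=> // u; have [->|/pB/ltW//] := eqVneq u 0.
by rewrite linear0.
Qed.

Lemma norm_of_gt0 {R : realType} {E : vectType R} (B : operator E) (u : E) :
  posdef B -> u != 0 -> 0 < norm_of B u.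
Proof. by case=> _ pB /pB Bu; rewrite sqrtr_gt0. Qed.

Lemma norm_ofZ {R : realType} {E : vectType R} (A : operator E) (a : R) (u : E) :
  norm_of A (a *: u) = `|a| * norm_of A u.
Proof.
rewrite /norm_of !linearZ /= scale_lfunE /GRing.scale /= mulrA -expr2.
by rewrite sqrtrM ?sqr_ge0// sqrtr_sqr.
Qed.

Lemma norm_ofN {R : realType} {E : vectType R} (A : operator E) (u : E) :
  norm_of A (- u) = norm_of A u.
Proof. by rewrite -scaleN1r norm_ofZ normrN1 mul1r. Qed.

Lemma quadratic_expansion {R : realType} {E : vectType R} (A : operator E)
    (h k : E) (t : R) : self_adjoint A ->
  A (h + t *: k) (h + t *: k)
    = (A h h : R) + 2 * t * (A h k : R) + t ^+ 2 * (A k k : R) :> R.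
Proof.
move=> sA; rewrite (_ : A (h + t *: k) = A h + t *: A k); last first.
  by rewrite linearD linearZ.
rewrite add_lfunE scale_lfunE !linearD !linearZ /= (sA k h) /GRing.scale /=.
by ring.
Qed.

(** The classical argument, expanding A w w >= 0 at w = <B v, v> u - <B u, v> v
to avoid dividing. *)
Lemma cauchy_schwarz {R : realType} {E : vectType R} (B : operator E) (u v : E) :
  posdef B -> (B u v : R) <= norm_of B u * norm_of B v.
Proof.
move=> pB; have psB := posdef_psd pB; have [sB B0] := psB.
have [->|v0] := eqVneq v 0; first by rewrite linear0 mulr_ge0 ?sqrtr_ge0.
rewrite (le_trans (ler_norm _))// -(ler_pXn2r (_ : 0 < 2)%N) ?nnegrE//; last first.
  by rewrite mulr_ge0 ?sqrtr_ge0.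
rewrite exprMn !sqr_norm_of// real_normK ?num_real//.
have vv : 0 < (B v v : R) by case: pB => _; apply.
have := B0 ((B v v : R) *: u - (B u v : R) *: v).
rewrite !linearB !linearZ /= !(add_lfunE, opp_lfunE, scale_lfunE) (sB v u).
rewrite /GRing.scale /=.
set a := (B u v : R); set b := (B v v : R); set c := (B u u : R).
rewrite [leRHS](_ : _ = b * (c * b - a ^+ 2)); last by ring.
by rewrite pmulr_rge0// subr_ge0.
Qed.

(** An injective operator between spaces of equal dimension is onto, so that the
pseudo-inverse in the dual norm is a true inverse and every functional is
represented by a vector of the same norm. *)
Lemma dual_norm_rep {R : realType} {E : vectType R} (B : operator E) (s : dual E) :
  posdef B -> exists2 u, s = B u & dual_norm B s = norm_of B u.
Proof.
move=> pB.
have kB : lker B == 0%VS.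
  apply/lker0P => u v Buv; apply/eqP; rewrite -subr_eq0; apply: contraT => uv.
  have := norm_of_gt0 pB uv.
  by rewrite /norm_of [B (u - v)]linearB /= Buv subrr zero_lfunE sqrtr0 ltxx.
have fB : s \in limg B.
  suff -> : limg B = fullv by rewrite memvf.
  apply/eqP; rewrite eqEdim subvf limg_dim_eq ?(eqP kB) ?capv0//.
  by rewrite !dimvf; change (dim E * 1 <= dim E)%N; rewrite muln1.
exists ((B^-1)%VF s); first by rewrite limg_lfunVK.
by rewrite /norm_of limg_lfunVK.
Qed.

Lemma le_dual_norm {R : realType} {E : vectType R} (B : operator E)
    (s : dual E) (v : E) :
  posdef B -> (s v : R) <= dual_norm B s * norm_of B v.
Proof. by move=> pB; have [u -> ->] := dual_norm_rep s pB; exact: cauchy_schwarz. Qed.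

Lemma norm_le_dual_norm {R : realType} {E : vectType R} (B : operator E)
    (s : dual E) (v : E) :
  posdef B -> `|s v : R| <= dual_norm B s * norm_of B v.
Proof.
move=> pB; rewrite ler_norml le_dual_norm// andbT lerNl.
by have := le_dual_norm s (- v) pB; rewrite linearN norm_ofN.
Qed.

Lemma dual_norm_le {R : realType} {E : vectType R} (B : operator E)
    (s : dual E) (K : R) :
  posdef B -> 0 <= K -> (forall v, (s v : R) <= K * norm_of B v) ->
  dual_norm B s <= K.
Proof.
move=> pB K0 sK; have [u su ->] := dual_norm_rep s pB.
have [u0|] := eqVneq u 0; first by rewrite /norm_of u0 linear0 sqrtr0.
move=> /(norm_of_gt0 pB) un; have := sK u.
by rewrite su -sqr_norm_of ?expr2 ?ler_pM2r//; exact: posdef_psd.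
Qed.

(** * The smallest curvature *)

Section MinCurvature.
Context {R : realType} {E : vectType R} (B : operator E).
Hypothesis pB : posdef B.

(** The supremum is attained: each quotient <A u, u> / <B u, u> bounds the set. *)
Lemma min_curvature_le (A : operator E) (u : E) :
  psd A -> min_curvature B A * norm_of B u ^+ 2 <= norm_of A u ^+ 2.
Proof.
move=> pA; rewrite !sqr_norm_of//; last exact: posdef_psd.
have [->|u0] := eqVneq u 0; first by rewrite !linear0 mulr0.
rewrite -ler_pdivlMr; last by case: pB => _; apply.
apply: ge_sup; first by exists 0; split; rewrite // scale0r subr0.
move=> l [_ [_ /(_ u)]]; rewrite add_lfunE opp_lfunE scale_lfunE.
rewrite add_lfunE opp_lfunE scale_lfunE subr_ge0 => H.
by rewrite ler_pdivlMr//; case: pB => _; apply.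
Qed.

(** A nonzero vector is what bounds the set whose supremum is taken. *)
Lemma le_min_curvature (A : operator E) (l : R) (u : E) :
  psd A -> u != 0 -> 0 <= l ->
  (forall v, l * norm_of B v ^+ 2 <= norm_of A v ^+ 2) -> l <= min_curvature B A.
Proof.
move=> pA u0 l0 lA; have psB := posdef_psd pB.
apply: ub_le_sup.
  exists ((A u u : R) / (B u u : R)) => m [_ [_ /(_ u)]].
  rewrite add_lfunE opp_lfunE scale_lfunE add_lfunE opp_lfunE scale_lfunE subr_ge0.
  by rewrite ler_pdivlMr//; case: pB => _; apply.
split=> //; split=> [v w|v].
  rewrite !(add_lfunE, opp_lfunE, scale_lfunE) (proj1 pA v w).
  by rewrite (proj1 psB v w).
rewrite !(add_lfunE, opp_lfunE, scale_lfunE) subr_ge0.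
by have := lA v; rewrite !sqr_norm_of.
Qed.

(** In the zero space the set is unbounded, and its supremum is 0 by
convention. *)
Lemma min_curvature_gt0_nontrivial (A : operator E) :
  0 < min_curvature B A -> exists u : E, u != 0.
Proof.
move=> A0; apply: contrapT => /forallNP E0.
have {}E0 (u : E) : u = 0 by apply/eqP; apply: contra_notT (E0 u).
have [[_ [m mA]]|/sup_out A0'] := pselect (has_sup
    [set l : R | 0 <= l /\ psd (A - l *: B)]); last by rewrite /min_curvature A0' ltxx in A0.
have /mA : [set l : R | 0 <= l /\ psd (A - l *: B)] (Num.max 0 (m + 1)).
  split; first by rewrite le_max lexx.
  by split=> [u v|u]; rewrite (E0 u) ?(E0 v)// linear0.
by rewrite ge_max => /andP[_]; rewrite gerDl ler10.
Qed.

End MinCurvature.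

(** * Derivatives along segments and quasi-self-concordance *)

Definition segment_closed {R : realType} {E : vectType R} (Q : set E) : Prop :=
  forall (x y : E) (t : R), Q x -> Q y -> 0 <= t <= 1 -> Q (x + t *: (y - x)).

(** A single chain rule for the function, the gradient and the Hessian: G is a
scalar reading of one of them, L z its derivative at z, and C the constant with
which the remainder in dual norm bounds that of the reading. *)
Lemma derive_on01_segment {R : realType} {E : vectType R} (B : operator E)
    (Q : set E) (G : E -> R) (L : E -> E -> R) (C : R) (x y : E) :
  segment_closed Q -> Q x -> Q y -> 0 <= C ->
  (forall z (a : R) h, L z (a *: h) = a * L z h) ->
  (forall z, Q z -> forall e : R, 0 < e -> exists2 d : R, 0 < d &
    forall w, Q w -> norm_of B (w - z) < d ->
      `|G w - G z - L z (w - z)| <= e * norm_of B (w - z) * C) ->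
  derive_on01 (fun t => G (x + t *: (y - x)))
              (fun t => L (x + t *: (y - x)) (y - x)).
Proof.
move=> Qc Qx Qy C0 LZ GL t t01 e e0.
set r := norm_of B (y - x); have r0 : 0 <= r by exact: sqrtr_ge0.
have e'0 : 0 < e / (1 + r * C) by rewrite divr_gt0// ltr_pwDl// mulr_ge0.
have [d d0 dP] := GL _ (Qc x y t Qx Qy t01) _ e'0.
exists (d / (1 + r)); first by rewrite divr_gt0// ltr_pwDl.
move=> u u01; rewrite ltr_pdivlMr ?ltr_pwDl// => ud.
have E1 : x + u *: (y - x) - (x + t *: (y - x)) = (u - t) *: (y - x).
  by rewrite opprD addrACA subrr add0r -scalerBl.
have := dP _ (Qc x y u Qx Qy u01); rewrite E1 norm_ofZ -/r LZ => H.
apply: (le_trans (H _)).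
  by rewrite (le_lt_trans _ ud)// ler_wpM2l// lerDr.
rewrite -mulrA -mulrA [leLHS](_ : _ = e * `|u - t| * (r * C / (1 + r * C))); last by ring.
rewrite ler_piMr ?mulr_ge0// ?(ltW e0)// ler_pdivrMr ?ltr_pwDl ?mulr_ge0//.
by rewrite mul1r lerDr.
Qed.

Section QuasiSelfConcordance.
Context {R : realType} {E : vectType R} (B : operator E) (Q : set E).
Context (grad : E -> dual E) (hess : E -> operator E).
Context (d3 : E -> trilinear_form E) (M : R).
Hypothesis pB : posdef B.
Hypothesis Qc : segment_closed Q.
Hypothesis gradD : hessian_on B Q grad hess.
Hypothesis hessD : third_derivative_on B Q hess d3.
Hypothesis hess_psd : forall z, Q z -> psd (hess z).
Hypothesis d3_sym : forall z, Q z -> symmetric_trilinear (d3 z).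
Hypothesis M0 : 0 < M.
Hypothesis qsc : quasi_self_concordant B Q hess d3 M.

Lemma grad_segment (x y v : E) : Q x -> Q y ->
  derive_on01 (fun t => grad (x + t *: (y - x)) v : R)
              (fun t => hess (x + t *: (y - x)) (y - x) v : R).
Proof.
move=> Qx Qy.
apply: (@derive_on01_segment _ _ B Q (fun z => grad z v : R)
  (fun z h => hess z h v : R) (norm_of B v)) => //.
- exact: sqrtr_ge0.
- by move=> z a h; rewrite linearZ scale_lfunE.
move=> z Qz e e0; have [d d0 dP] := gradD Qz e0.
exists d => // w Qw wd.
rewrite (le_trans _ (ler_wpM2r (sqrtr_ge0 _) (dP w Qw wd)))//.
by rewrite (le_trans _ (norm_le_dual_norm _ _ pB))// !(add_lfunE, opp_lfunE).
Qed.

Lemma hess_segment (x y u v : E) : Q x -> Q y ->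
  derive_on01 (fun t => hess (x + t *: (y - x)) u v : R)
              (fun t => d3 (x + t *: (y - x)) (y - x) u v : R).
Proof.
move=> Qx Qy.
apply: (@derive_on01_segment _ _ B Q (fun z => hess z u v : R)
  (fun z h => d3 z h u v : R) (norm_of B u * norm_of B v)) => //.
- by rewrite mulr_ge0 ?sqrtr_ge0.
- by move=> z a h; rewrite linearZ !scale_lfunE.
move=> z Qz e e0; have [d d0 dP] := hessD Qz e0.
exists d => // w Qw wd; rewrite mulrA.
rewrite (le_trans _ (ler_wpM2r (sqrtr_ge0 _) (dP w Qw wd u)))//.
by rewrite (le_trans _ (norm_le_dual_norm _ _ pB))// !(add_lfunE, opp_lfunE).
Qed.

(** The symmetry of the third derivative brings D^3 f[y - x, u, u] to the form
D^3 f[u, u, y - x] controlled by quasi-self-concordance. *)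
Lemma hess_growth (x y u : E) : Q x -> Q y ->
  norm_of (hess y) u ^+ 2
    <= expR (M * norm_of B (y - x)) * norm_of (hess x) u ^+ 2.
Proof.
move=> Qx Qy; have := gronwall_le (hess_segment u u Qx Qy).
rewrite scale1r subrKC scale0r addr0 !sqr_norm_of; [|exact: hess_psd..].
apply=> t t01; have Qz := Qc Qx Qy t01.
have [-> _] := d3_sym Qz (y - x) u u; have [_ ->] := d3_sym Qz u (y - x) u.
rewrite (le_trans (qsc Qz _ _))// sqr_norm_of; last exact: hess_psd.
by rewrite mulrAC.
Qed.

(** The growth bound from y to x, read as a lower bound on hess y. *)
Lemma min_curvature_segment (x y u : E) : Q x -> Q y -> u != 0 ->
  0 <= min_curvature B (hess x) ->
  expR (- (M * norm_of B (y - x))) * min_curvature B (hess x)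
    <= min_curvature B (hess y).
Proof.
move=> Qx Qy u0 lx; apply: (le_min_curvature pB (hess_psd Qy) u0).
  by rewrite mulr_ge0// expR_ge0.
move=> v; rewrite expRN -mulrA ler_pdivrMl ?expR_gt0//.
rewrite (le_trans (min_curvature_le pB v (hess_psd Qx)))//.
by rewrite (le_trans (hess_growth v Qy Qx))// -(norm_ofN B (x - y)) opprB.
Qed.

(** A crude form of the bound with the factor (e^(M r) - 1 - M r) / (M r)^2 in
place of e^(M r): the mean value inequality replaces both integrals of D^3 f by
the largest value of the integrand. *)
Lemma grad_taylor (x y : E) : Q x -> Q y ->
  dual_norm B (grad y - grad x - hess x (y - x))
    <= M * expR (M * norm_of B (y - x)) * norm_of (hess x) (y - x) ^+ 2.
Proof.
move=> Qx Qy; apply: dual_norm_le => //.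
  by rewrite mulr_ge0 ?sqr_ge0// mulr_ge0 ?expR_ge0// ltW.
move=> v; set K := _ * norm_of B v.
have := @mean_value_le _ _ _ ((hess x (y - x) v : R) + K) (grad_segment v Qx Qy).
rewrite scale1r subrKC scale0r addr0 !(add_lfunE, opp_lfunE) => H.
(* It remains to bound the derivative <hess(x + t h) h, v>, by the mean value
   inequality between x and x + t h. *)
rewrite lerBlDl; apply: H => t t01.
have Qz := Qc Qx Qy t01; have /andP[t0 t1] := t01; rewrite -lerBlDl.
have := @mean_value_le _ _ _ K (hess_segment (y - x) v Qx Qz).
rewrite scale1r subrKC scale0r addr0; apply=> s s01; have /andP[s0 s1] := s01.
rewrite addrAC subrr add0r linearZ !scale_lfunE scalerA.
have Qw : Q (x + (s * t) *: (y - x)).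
  by apply: Qc => //; rewrite mulr_ge0//= mulr_ile1.
have K0 : 0 <= K.
  rewrite mulr_ge0 ?sqrtr_ge0// mulr_ge0 ?sqr_ge0// mulr_ge0 ?expR_ge0//.
  exact: ltW.
have H : (d3 (x + (s * t) *: (y - x)) (y - x) (y - x) v : R) <= K.
  rewrite (le_trans (qsc Qw _ _))// ler_wpM2r ?sqrtr_ge0// -mulrA.
  rewrite ler_wpM2l ?(ltW M0)// (le_trans (hess_growth _ Qx Qw))//.
  rewrite ler_wpM2r ?sqr_ge0// ler_expR ler_wpM2l ?(ltW M0)//.
  rewrite addrAC subrr add0r norm_ofZ ler_piMl ?sqrtr_ge0//.
  by rewrite ger0_norm ?mulr_ge0// mulr_ile1.
by rewrite (le_trans (ler_wpM2l t0 H))// ler_piMl.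
Qed.

End QuasiSelfConcordance.

(** * Optimality for a smooth function plus psi *)

Section CompositeOptimality.
Context {R : realType} {E : vectType R} (psi : E -> \bar R).
Hypothesis psi_proper : proper_function psi.
Hypothesis psi_convex : convex_efunction psi.

Lemma dom_fineK (x : E) : dom psi x -> (fine (psi x))%:E = psi x.
Proof.
by move=> dx; rewrite fineK// fin_numE (proj1 psi_proper)/= lt_eqF.
Qed.

Lemma segment_convexity (z y : E) (t : R) : 0 <= t <= 1 ->
  (psi (z + t *: (y - z)) <= t%:E * psi y + (1 - t)%:E * psi z)%E.
Proof.
have -> : z + t *: (y - z) = t *: y + (1 - t) *: z.
  by rewrite scalerBr scalerBl scale1r addrCA.
exact: psi_convex.
Qed.

Lemma dom_segment_closed : segment_closed (dom psi).
Proof.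
move=> x y t dx dy t01; rewrite /dom /=.
apply: (le_lt_trans (segment_convexity x y t01)).
by rewrite -(dom_fineK dx) -(dom_fineK dy) -!EFinM -EFinD ltry.
Qed.

(** Stated over the reals, since psi is finite on its domain. *)
Definition dom_subgradient (x : E) (w : dual E) : Prop :=
  forall y, dom psi y -> fine (psi x) + (w (y - x) : R) <= fine (psi y).

(** G may be nonconvex: convexity of psi bounds psi on a short initial part of
the segment from z to y by the chord, and G is compared with its one-sided
slope a. *)
Lemma first_order_optimality (G : E -> R) (z y : E) (a : R) :
  dom psi z -> dom psi y ->
  (forall y', dom psi y' -> G z + fine (psi z) <= G y' + fine (psi y')) ->
  (forall e : R, 0 < e -> exists2 d : R, 0 < d &
    forall t : R, 0 < t <= 1 -> t < d -> G (z + t *: (y - z)) - G z <= t * (a + e)) ->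
  fine (psi z) <= fine (psi y) + a.
Proof.
move=> dz dy zmin Ga; apply/ler_addgt0Pr => e e0.
have [d d0 dP] := Ga e e0; pose t := Num.min 1 (d / 2).
have t0 : 0 < t by rewrite lt_min ltr01 divr_gt0.
have t1 : t <= 1 by rewrite ge_min lexx.
have td : t < d by rewrite gt_min ltr_pdivrMr// ltr_pMr// ltr1n orbT.
have t01 : 0 <= t <= 1 by rewrite ltW.
have dw := dom_segment_closed dz dy t01.
have := segment_convexity z y t01.
rewrite -(dom_fineK dz) -(dom_fineK dy) -(dom_fineK dw) -!EFinM -EFinD lee_fin.
have := dP t _ td; rewrite t0 t1 => /(_ isT).
have := zmin _ dw; set p := fine (psi (z + _)); set g := G (_ + _).
move=> H1 H2 H3; rewrite -(ler_pM2l t0); lra.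
Qed.

Lemma objective_subgradient (B : operator E) (f : E -> R) (grad : E -> dual E)
    (x : E) (s : dual E) :
  gradient_on B (dom psi) f grad -> dom psi x ->
  subdifferential (objective f psi) x s -> dom_subgradient x (s - grad x).
Proof.
move=> fD dx sF y dy.
rewrite -lerBrDr.
apply: (@first_order_optimality (fun w => f w - (s (w - x) : R))) => //.
  move=> w dw; rewrite subrr linear0 subr0.
  have := sF w; rewrite /objective -(dom_fineK dx) -(dom_fineK dw) -!EFinD lee_fin.
  by move=> H; lra.
move=> e e0.
have fD1 : derive_on01 (fun t => f (x + t *: (y - x)))
    (fun t => grad (x + t *: (y - x)) (y - x) : R).
  apply: (@derive_on01_segment _ _ B (dom psi) f
    (fun z h => grad z h : R) 1) => //; first exact: dom_segment_closed.
    by move=> z a h; rewrite linearZ.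
  move=> z dz e' e'0; have [d d0 dP] := fD z dz e' e'0.
  by exists d => // w dw wd; rewrite mulr1; exact: dP.
have [|d d0 dP] := fD1 0 _ e e0; first by rewrite lexx ler01.
exists d => // t /andP[t0 t1] td.
have := dP t; rewrite subr0 scale0r addr0 (gtr0_norm t0) (ltW t0) t1.
move=> /(_ isT td); rewrite ler_norml => /andP[_].
rewrite /= subrr linear0 subr0 [x + _ - x]addrAC subrr add0r add_lfunE opp_lfunE.
rewrite (_ : s (t *: _) = t * (s (y - x) : R)); last by rewrite linearZ.
set g := (grad x _ : R); set c := (s _ : R); set p := f (_ + _).
by move=> H; lra.
Qed.

(** The model is quadratic with Hessian A = hess z + r B; its slope at x is read
off the exact expansion along the segment. *)
Lemma newton_step_optimality (B : operator E) (grad : E -> dual E)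
    (hess : E -> operator E) (r : R) (z x : E) :
  psd B -> psd (hess z) ->
  argmin (dom psi) (newton_model B grad hess psi r z) x ->
  dom_subgradient x (- (grad z + hess z (x - z) + r *: B (x - z))).
Proof.
move=> psB psH [dx xmin] y dy.
rewrite opp_lfunE -lerBrDr opprK.
pose A := hess z + r *: B.
have EA u : (2^-1 * norm_of (hess z) u ^+ 2 + r / 2 * norm_of B u ^+ 2)
    = 2^-1 * (A u u : R).
  rewrite !sqr_norm_of// !(add_lfunE, scale_lfunE) /GRing.scale /=.
  by field.
apply: (@first_order_optimality
  (fun w => (grad z (w - z) : R) + 2^-1 * (A (w - z) (w - z) : R))) => //.
  move=> w dw; have := xmin w dw; rewrite /newton_model -!addrA !EA.
  by rewrite -(dom_fineK dx) -(dom_fineK dw) -!EFinD lee_fin !addrA.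
move=> e e0.
set h := x - z; set k := y - x.
(* The only term of second order in t is t^2 <A k, k> / 2. *)
exists (e / (1 + `|A k k : R|)); first by rewrite divr_gt0// ltr_pwDl.
move=> t /andP[t0 t1]; rewrite ltr_pdivlMr ?ltr_pwDl// => te.
have -> : x + t *: k - z = h + t *: k by rewrite addrAC.
have Asym : self_adjoint A.
  move=> u v; rewrite /A !(add_lfunE, scale_lfunE) (proj1 psB u v).
  by rewrite (proj1 psH u v).
have Eg : grad z (h + t *: k) = (grad z h : R) + t * (grad z k : R) :> R.
  by rewrite linearD linearZ.
have Ea : (grad z + hess z h + r *: B h) k = (grad z k : R) + (A h k : R) :> R.
  by rewrite /A !(add_lfunE, scale_lfunE) addrA.
rewrite (quadratic_expansion _ _ _ Asym) Eg Ea.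
have tA : t * (A k k : R) <= e.
  have := ler_norm (A k k : R); have := normr_ge0 (A k k : R).
  by move: te; set n := `|_|; set q := (A k k : R); nra.
have := ler_wpM2l (ltW t0) tA.
have : 0 <= t * e by rewrite mulr_ge0// ltW.
by rewrite expr2; lra.
Qed.

End CompositeOptimality.

(** * The quadratic rate *)

(** One iteration as inequalities between numbers: n stands for ||h||_x^2, and
the primed quantities belong to the next iterate. *)
Lemma newton_contraction {R : realType} (M g g' l l' r n sg : R) :
  0 < M -> 0 <= g -> 0 < l -> 0 <= sg <= 2 * M -> 0 <= r ->
  l * r ^+ 2 <= n -> n + sg * g * r ^+ 2 <= g * r ->
  g' <= M * expR (M * r) * n + sg * g * r ->
  expR (- (M * r)) * l <= l' ->
  g / l <= (18 * M)^-1 ->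
  g' / l' <= 9 * M * (g / l) ^+ 2.
Proof.
move=> M0 g0 l0 /andP[s0 s1] r0 ln ng g'le ll' small.
pose eta := g / l; have gE : g = eta * l by rewrite divfK// gt_eqF.
have eta0 : 0 <= eta by rewrite divr_ge0// ltW.
have sgr : 0 <= sg * g * r ^+ 2 by rewrite !mulr_ge0.
have r_eta : r <= eta.
  rewrite ler_pdivlMr//; have [->|rN0] := eqVneq r 0; first by rewrite mul0r.
  have rp : 0 < r by rewrite lt_def rN0.
  by rewrite -(ler_pM2r rp); lra.
have n_le : n <= g * eta by have := ler_wpM2l g0 r_eta; lra.
have Mr : M * r <= 18^-1.
  rewrite (le_trans (ler_wpM2l (ltW M0) (le_trans r_eta small)))//.
  by rewrite invfM mulrCA divff ?mulr1// gt_eqF.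
(* From 1 - M r <= e^(- M r), which keeps all constants rational. *)
have expN : 17 / 18 <= expR (- (M * r)).
  by have := expR_ge1Dx (- (M * r)); lra.
have expP : expR (M * r) <= 18 / 17.
  by have := ler_wpM2l (expR_ge0 (M * r)) expN; rewrite expRxMexpNx_1; lra.
have g'_le : g' <= (18 / 17 + 2) * (M * eta ^+ 2 * l).
  have H1 : M * expR (M * r) * n <= M * (18 / 17) * (g * eta).
    rewrite -[leLHS]mulrA -[leRHS]mulrA ler_pM2l//.
    rewrite (le_trans (ler_wpM2l (expR_ge0 _) n_le))//.
    by rewrite ler_wpM2r// mulr_ge0.
  have H2 : sg * g * r <= 2 * M * (g * eta).
    rewrite -mulrA (le_trans (ler_wpM2l s0 (ler_wpM2l g0 r_eta)))//.
    by rewrite ler_wpM2r// mulr_ge0.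
  apply: (le_trans g'le); apply: (le_trans (lerD H1 H2)).
  by rewrite gE; lra.
have l'_ge : 17 / 18 * l <= l' by rewrite (le_trans _ ll')// ler_wpM2r// ltW.
have l'0 : 0 < l' by rewrite (lt_le_trans _ l'_ge)// mulr_gt0.
rewrite ler_pdivrMr// -/eta (le_trans g'_le)//.
have W0 : 0 <= M * eta ^+ 2 by rewrite mulr_ge0 ?sqr_ge0// ltW.
have := ler_wpM2l W0 l'_ge.
have : 0 <= M * eta ^+ 2 * l by rewrite mulr_ge0// ltW.
by lra.
Qed.

Lemma quadratic_rate {R : realType} (M : R) (eta : nat -> R) :
  0 < M -> (forall k, 0 <= eta k) -> eta 0%N <= (18 * M)^-1 ->
  (forall k, eta k <= (18 * M)^-1 -> eta k.+1 <= 9 * M * eta k ^+ 2) ->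
  forall k, eta k <= (9 * M)^-1 * 2^-1 ^+ (2 ^ k).
Proof.
move=> M0 eta0 start step.
have halve : (9 * M)^-1 * 2^-1 = (18 * M)^-1.
  by rewrite -invfM mulrAC -natrM.
have M9 : 0 < 9 * M by rewrite mulr_gt0.
elim=> [|k IH]; first by rewrite expr1 halve.
apply: le_trans (step k _) _.
  rewrite (le_trans IH)// -halve ler_wpM2l ?invr_ge0 ?(ltW M9)//.
  rewrite -[leRHS]expr1 ler_wiXn2l ?invr_ge0// ?expn_gt0//.
  by rewrite invf_le1// ler1n.
have -> : (9 * M)^-1 * 2^-1 ^+ (2 ^ k.+1) = 9 * M * ((9 * M)^-1 * 2^-1 ^+ (2 ^ k)) ^+ 2.
  rewrite exprMn -exprM -expnSr mulrA; congr (_ * _).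
  by rewrite expr2 mulrA divff ?mul1r// gt_eqF.
rewrite ler_pM2l// ler_pXn2r// nnegrE//.
by rewrite mulr_ge0// ?exprn_ge0 ?invr_ge0// ltW.
Qed.

Theorem theorem4p1 (R : realType) (E : vectType R) (B : operator E)
  (f : E -> R) (grad : E -> dual E) (hess : E -> operator E)
  (d3 : E -> trilinear_form E) (psi : E -> \bar R) (M : R)
  (x0 : E) :
  posdef B ->
  proper_function psi -> closed_function B psi -> convex_efunction psi ->
  convex_function (dom psi) f ->
  gradient_on B (dom psi) f grad ->
  hessian_on B (dom psi) grad hess ->
  third_derivative_on B (dom psi) hess d3 ->
  (forall z, dom psi z -> psd (hess z)) ->
  (forall z, dom psi z -> symmetric_trilinear (d3 z)) ->
  argmin (dom psi) (objective f psi) !=set0 ->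
  0 < M ->
  quasi_self_concordant B (dom psi) hess d3 M ->
  let lambda z := min_curvature B (hess z) in
  dom psi x0 -> 0 < lambda x0 ->
  (forall z, dom psi z -> 0 < lambda z) /\
  (forall (sigma : nat -> R) (x : nat -> E) (s : nat -> dual E),
    (forall k, 0 <= sigma k <= 2 * M) ->
    newton_iterates B f grad hess psi x0 sigma x s ->
    let eta k := dual_norm B (s k) / lambda (x k) in
    eta 0%N <= (18 * M)^-1 ->
    forall k, eta k <= (9 * M)^-1 * 2^-1 ^+ (2 ^ k)).
Proof.
move=> pB psi_proper _ psi_cvx _ fD gradD hessD hess_psd d3_sym _ M0 qsc lambda dx0 lx0.
have Qc := dom_segment_closed psi_proper psi_cvx.
have [u u0] := min_curvature_gt0_nontrivial lx0.
(* A fixed nonzero vector u witnesses that the space is nontrivial. *)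
have hess_cmp x y := @min_curvature_segment _ _ _ _ _ _ _ pB Qc hessD
  hess_psd d3_sym qsc x y u.
have lambda_gt0 z : dom psi z -> 0 < lambda z.
  move=> dz; apply: lt_le_trans (hess_cmp x0 z dx0 dz u0 (ltW lx0)).
  by rewrite mulr_gt0 ?expR_gt0.
split=> // sigma x s sigmaM [xE0 s0 xS sS] eta small.
have dx k : dom psi (x k) by case: k => [|k]; [rewrite xE0|have [] := xS k].
have opt k : dom_subgradient psi (x k.+1) (s k.+1 - grad (x k.+1)).
  rewrite sS (_ : _ - grad _ = - (grad (x k) + hess (x k) (x k.+1 - x k)
      + (sigma k * dual_norm B (s k)) *: B (x k.+1 - x k))).
    apply: newton_step_optimality (xS k) => //; first exact: posdef_psd.
    exact: hess_psd.
  by rewrite !opprD addrC !addrA addNr add0r.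
have subg k : dom_subgradient psi (x k) (s k - grad (x k)).
  case: k => // ; apply: objective_subgradient fD (dx 0%N) _ => //.
  by rewrite xE0.
apply: quadratic_rate => // [k|k small_k].
  by apply: divr_ge0; [exact: sqrtr_ge0|exact/ltW/lambda_gt0].
set h := x k.+1 - x k; set g := dual_norm B (s k).
apply: (@newton_contraction _ M _ _ _ _ (norm_of B h) (norm_of (hess (x k)) h ^+ 2)
  (sigma k)).
- exact: M0.
- exact: sqrtr_ge0.
- exact: lambda_gt0.
- exact: sigmaM.
- exact: sqrtr_ge0.
- by apply: min_curvature_le => //; exact: hess_psd.
(* The subgradient inequalities of psi at both iterates, each tested at the
   other one. *)
- have optE : (s k.+1 - grad (x k.+1)) (x k - x k.+1) = (grad (x k) h : R)
      + (hess (x k) h h : R) + sigma k * g * (B h h : R) :> R.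
    rewrite -(opprB (x k.+1)) -/h sS -/h -/g. 
    rewrite !(add_lfunE, opp_lfunE, scale_lfunE). rewrite /GRing.scale /=.
    by ring.
  have subE : (s k - grad (x k)) h = (s k h : R) - (grad (x k) h : R) :> R.
    by rewrite add_lfunE opp_lfunE.
  have CS : - (s k h : R) <= g * norm_of B h.
    by have := le_dual_norm (s k) (- h) pB; rewrite linearN norm_ofN.
  have := opt k _ (dx k); have := subg k _ (dx k.+1).
  rewrite optE -/h -/g subE.
  rewrite (sqr_norm_of _ (hess_psd _ (dx k))) (sqr_norm_of _ (posdef_psd pB)).
  move: CS; move: (s k h : R) (grad (x k) h : R) (hess (x k) h h : R) (B h h : R) (g * _).
  move: (sigma k * g) (fine (psi (x k))) (fine (psi (x k.+1))); clear.
  by move=> *; lra.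
(* The new residual is the linearization error minus sigma g B h. *)
- have T := @grad_taylor _ _ _ _ _ _ _ _ pB Qc gradD hessD hess_psd d3_sym M0 qsc
    _ _ (dx k) (dx k.+1).
  have sg0 : 0 <= sigma k * g * norm_of B h.
    by rewrite !mulr_ge0 ?sqrtr_ge0//; case/andP: (sigmaM k).
  apply: dual_norm_le => // [|v].
    by rewrite addr_ge0// (le_trans _ T)// sqrtr_ge0.
  rewrite sS -/h -/g add_lfunE opp_lfunE scale_lfunE mulrDl lerD//.
    by rewrite (le_trans (le_dual_norm _ v pB))// ler_wpM2r ?sqrtr_ge0.
  have H := cauchy_schwarz (- h) v pB.
  rewrite linearN opp_lfunE norm_ofN in H.
  rewrite (_ : - _ = sigma k * g * - (B h v : R)); last by rewrite mulrN.
  rewrite -[leRHS]mulrA ler_wpM2l//.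
    by rewrite mulr_ge0 ?sqrtr_ge0//; case/andP: (sigmaM k).
- exact: (hess_cmp _ _ (dx k) (dx k.+1) u0 (ltW (lambda_gt0 _ (dx k)))).
- exact: small_k.
Qed.
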